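(* Let $\ell_1$ and $\ell_2$ be primitive binary $\mathbb{Z}$-lattices such that the pair $(\ell_1,\ell_2)$ is not buried in rank $2$. Then the following are equivalent. (i) The pair $(\ell_1,\ell_2)$ is buried in rank $3$. (ii) There exists a positive integer $a$ primitively represented by both $\ell_1$ and $\ell_2$ such that the following open interval contains an integer: $$I_{\ell_1,\ell_2,a}:=\left(\frac{b_1b_2-\sqrt{d\ell_1\, d\ell_2}}{a},\ \frac{b_1b_2+\sqrt{d\ell_1\, d\ell_2}}{a}\right),$$ where $\ell_1\cong\begin{pmatrix} a&b_1\\ b_1&c_1\end{pmatrix}$ and $\ell_2\cong\begin{pmatrix} a&b_2\\ b_2&c_2\end{pmatrix}$ (bases chosen so that the first basis vector has norm $a$).
   Context: Throughout, a $\mathbb{Z}$-lattice means a positive definite integral $\mathbb{Z}$-lattice (a free $\mathbb{Z}$-module with a non-degenerate symmetric bilinear form $B$ with $B(x,y)\in\mathbb{Z}$ and $Q(x)=B(x,x)>0$ for $x\neq 0$); $dL$ denotes the discriminant (determinant of the Gram matrix) of $L$. A lattice $\ell$ is represented by $L$ if there is a linear map $\sigma:\ell\to L$ preserving $B$. For $\mathbb{Z}$-lattices $\ell_1,\ell_2$ of rank $m$, the pair $(\ell_1,\ell_2)$ is said to be buried in rank $n$ if there is a $\mathbb{Z}$-lattice $L$ of rank $n$ representing both $\ell_1$ and $\ell_2$. A $\mathbb{Z}$-lattice $L$ is primitive if there is no integral $\mathbb{Z}$-lattice properly containing $L$ on the quadratic $\mathbb{Q}$-space $\mathbb{Q}L$.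 *)

(* Defs.v *)
From HB Require Import structures.
From mathcomp Require Import all_boot all_order all_algebra.
From mathcomp Require Import classical_sets reals.

Set Implicit Arguments.
Unset Strict Implicit.
Unset Printing Implicit Defensive.

Import Order.TTheory GRing.Theory Num.Theory.
Local Open Scope classical_set_scope.
Local Open Scope ring_scope.

(* A Z-lattice of rank n is Z^n = 'rV[int]_n with the bilinear form of a Gram
   matrix G : 'M[int]_n; the quadratic space QL is 'rV[rat]_n with the form of
   the same matrix. *)

Definition bform (R : nzRingType) (n : nat) (G : 'M[R]_n) (x y : 'rV[R]_n) : R :=
  (x *m G *m y^T) 0 0.

Definition qform (R : nzRingType) (n : nat) (G : 'M[R]_n) (x : 'rV[R]_n) : R :=
  bform G x x.

Definition zlattice (n : nat) (G : 'M[int]_n) : Prop :=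
  G^T = G /\ (forall x : 'rV[int]_n, x != 0 -> 0 < qform G x).

Definition represented_by (m n : nat) (l : 'M[int]_m) (L : 'M[int]_n) : Prop :=
  exists sigma : {linear 'rV[int]_m -> 'rV[int]_n},
    forall x y, bform L (sigma x) (sigma y) = bform l x y.

Definition isometric (n : nat) (L K : 'M[int]_n) : Prop :=
  exists2 sigma : {linear 'rV[int]_n -> 'rV[int]_n},
    bijective sigma & forall x y, bform K (sigma x) (sigma y) = bform L x y.

Definition buried (m n : nat) (l1 l2 : 'M[int]_m) : Prop :=
  exists L : 'M[int]_n,
    [/\ zlattice L, represented_by l1 L & represented_by l2 L].

Arguments buried {m} n l1 l2.

(* Full-rank lattices in Q^n: the Z-spans of the Q-bases of Q^n. *)
Definition lattice_on_space (n : nat) (M : set 'rV[rat]_n) : Prop :=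
  exists2 P : 'M[rat]_n, P \in unitmx &
    M = range (fun u : 'rV[int]_n => map_mx intr u *m P).

Definition integral_on (n : nat) (G : 'M[int]_n) (M : set 'rV[rat]_n) : Prop :=
  forall x y, M x -> M y -> bform (map_mx intr G) x y \is a Num.int.

Definition Zn_in_Qn (n : nat) : set 'rV[rat]_n :=
  range (fun u : 'rV[int]_n => map_mx intr u).

Definition primitive_lattice (n : nat) (L : 'M[int]_n) : Prop :=
  ~ exists M : set 'rV[rat]_n,
      [/\ lattice_on_space M, integral_on L M & @Zn_in_Qn n `<` M].

(* In particular 0 is not primitive, since 0 = 2 *: 0. *)
Definition primitive_vector (n : nat) (x : 'rV[int]_n) : Prop :=
  forall (k : int) (y : 'rV[int]_n), x = k *: y -> `|k| = 1.

Definition primitively_represents (n : nat) (L : 'M[int]_n) (a : int) : Prop :=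
  exists2 x : 'rV[int]_n, primitive_vector x & qform L x = a.

Definition binary_gram (a b c : int) : 'M[int]_2 :=
  \matrix_(i, j) if i == j then (if i == 0 then a else c) else b.

Definition burying_interval (R : realType) (l1 l2 : 'M[int]_2) (a b1 b2 : int) :
    interval R :=
  let s := Num.sqrt ((\det l1)%:~R * (\det l2)%:~R) in
  `] ((b1 * b2)%:~R - s) / a%:~R, ((b1 * b2)%:~R + s) / a%:~R [.

(* Main.v *)
(** If [l1] and [l2] both embed in a ternary [L], primitivity makes their images
saturated in [L], so the planes they span are distinct (otherwise [l1] already
represents [l2]) and meet in a line whose primitive vector is primitive in both;
its norm is [a]. Completing it to bases with second vectors [y1], [y2] and
setting [t = B(y1, y2)], the Gram matrix [G] of the three vectors satisfies
[a * det G = d1 * d2 - (a * t - b1 * b2)^2], so its positivity says exactly that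
[t] lies in the interval. Conversely, for such a [t] the matrix [G] is itself a
ternary lattice representing both. *)

Require Import Defs.
From HB Require Import structures.
From mathcomp Require Import all_boot all_order all_algebra.
From mathcomp Require Import classical_sets reals.
From mathcomp Require boolp.
From mathcomp Require Import ring.

Set Implicit Arguments.
Unset Strict Implicit.
Unset Printing Implicit Defensive.

Import Order.TTheory GRing.Theory Num.Theory.
Local Open Scope ring_scope.

(** * Representations and isometries in matrix form *)

Lemma bform_mul (R : comNzRingType) (m n : nat) (S : 'M[R]_(m, n)) (G : 'M[R]_n) x y :
  bform G (x *m S) (y *m S) = bform (S *m G *m S^T) x y.
Proof. by rewrite /bform trmx_mul !mulmxA. Qed.

Lemma bform_ext (R : nzRingType) (n : nat) (G H : 'M[R]_n) :
  (forall x y, bform G x y = bform H x y) -> G = H.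
Proof.
move=> eGH; apply/matrixP=> i j.
have coef (M : 'M[R]_n) : bform M (delta_mx 0 i) (delta_mx 0 j) = M i j.
  by rewrite /bform -rowE trmx_delta -colE !mxE.
by rewrite -!coef.
Qed.

Lemma represented_byP (m n : nat) (l : 'M[int]_m) (L : 'M[int]_n) :
  represented_by l L <-> exists S : 'M[int]_(m, n), S *m L *m S^T = l.
Proof.
split=> [[s es] | [S <-]]; last by exists (mulmxr S) => x y; rewrite /= bform_mul.
by exists (lin1_mx s); apply: bform_ext => x y; rewrite -es -bform_mul !mul_rV_lin1.
Qed.

Lemma isometricP (n : nat) (L K : 'M[int]_n) :
  isometric L K <-> exists2 V : 'M[int]_n, V \in unitmx & V *m L *m V^T = K.
Proof.
split=> [[s [g sK gK] es] | [V Vu eK]].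
  have gs x : g x *m lin1_mx s = x by rewrite mul_rV_lin1 gK.
  (* [g] is only a set-theoretic inverse, so its matrix is assembled from its values on the standard
     basis. *)
  pose W := \matrix_i g (delta_mx 0 i).
  have WS : W *m lin1_mx s = 1%:M.
    by apply/row_matrixP=> i; rewrite row_mul rowK gs rowE mulmx1.
  exists W; first exact: (mulmx1_unit WS).1.
  apply: bform_ext => x y.
  by rewrite -bform_mul -es -!mul_rV_lin1 -!mulmxA WS !mulmx1.
exists (mulmxr (invmx V)); last by move=> x y; rewrite /= -eK -bform_mul !mulmxKV.
by exists (mulmxr V) => x /=; rewrite ?mulmxK ?mulmxKV.
Qed.

Lemma zlattice_det_neq0 (n : nat) (G : 'M[int]_n) : zlattice G -> \det G != 0.
Proof.
case=> _ Gpos; apply/negP=> /det0P[v v0 vG].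
by have := Gpos v v0; rewrite /qform /bform vG mul0mx mxE ltxx.
Qed.

Lemma bformC (R : comNzRingType) (n : nat) (G : 'M[R]_n) x y :
  G^T = G -> bform G x y = bform G y x.
Proof.
move=> Gs; rewrite /bform.
have -> : y *m G *m x^T = (x *m G *m y^T)^T by rewrite !trmx_mul trmxK Gs mulmxA.
by rewrite [RHS]mxE.
Qed.

(** * Saturation of sublattices *)

(** In the Smith form of [S], the invariant factors are absorbed into [A], and [S'] consists of the
    first [n] rows of the unimodular right factor [U]. The column blocks [T], [N] of the inverse of
    [U] then show that the rows of [S'] span a direct summand, cut out by [N]. *)
Lemma saturation (n k : nat) (S : 'M[int]_(n, n + k)) :
  exists (A : 'M[int]_n) (S' : 'M_(n, n + k)) T (N : 'M_(n + k, k)) K,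
    [/\ S = A *m S', S' *m T = 1%:M, S' *m N = 0 & T *m S' + N *m K = 1%:M].
Proof.
have [L Lu [U Uu [d _ ->]]] := int_Smith_normal_form S.
exists (L *m diag_mx (\row_i d`_i)), (usubmx U), (lsubmx (invmx U)).
exists (rsubmx (invmx U)), (dsubmx U).
have UV : col_mx (usubmx U) (dsubmx U) *m row_mx (lsubmx (invmx U)) (rsubmx (invmx U)) = 1%:M.
  by rewrite hsubmxK vsubmxK mulmxV.
have VU : row_mx (lsubmx (invmx U)) (rsubmx (invmx U)) *m col_mx (usubmx U) (dsubmx U) = 1%:M.
  by rewrite hsubmxK vsubmxK mulVmx.
move: UV VU; rewrite mul_col_row mul_row_col scalar_mx_block.
case/eq_block_mx=> -> -> _ _ ->; split=> //.
rewrite -!mulmxA; congr (_ *m _); rewrite -{1}(vsubmxK U).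
have -> : \matrix_(i < n, j < n + k) (d`_i *+ (i == j :> nat)) =
          row_mx (diag_mx (\row_i d`_i)) 0.
  apply/matrixP=> i j; rewrite !mxE; case: splitP => h jh; rewrite !mxE jh //.
  by rewrite (ltn_eqF (leq_trans (ltn_ord i) (leq_addr _ _))).
by rewrite mul_row_col mul0mx addr0.
Qed.

Lemma map_intr_inj (m n : nat) : injective (@map_mx int rat intr m n).
Proof.
move=> A B /matrixP eAB; apply/matrixP=> i j.
by have := eAB i j; rewrite !mxE => /intr_inj.
Qed.

(** The saturation of the image of [l] in [L] is an integral overlattice of [l]. Primitivity makes
    it equal to [l], so the factor [A] is invertible over the integers. *)
Lemma primitive_saturated (n k : nat) (l : 'M[int]_n) (L : 'M_(n + k)) (S : 'M_(n, n + k)) :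
  \det l != 0 -> primitive_lattice l -> S *m L *m S^T = l ->
  exists T (N : 'M_(n + k, k)) K,
    [/\ S *m T = 1%:M, S *m N = 0 & T *m S + N *m K = 1%:M].
Proof.
move=> dl lprim eS; have [A [S' [T [N [K [eA S'T S'N TN]]]]]] := saturation S.
have el : l = A *m (S' *m L *m S'^T) *m A^T by rewrite -eS eA trmx_mul !mulmxA.
pose Aq : 'M[rat]_n := map_mx intr A.
have Au : Aq \in unitmx.
  rewrite unitmxE det_map_mx unitfE intr_eq0; apply: contraNneq dl => dA.
  by rewrite el !det_mulmx dA !mul0r.
(* [M] is the lattice [{x | x *m S is integral}], the saturation of [l] in [L]. *)
pose M : set 'rV[rat]_n := range (fun u : 'rV[int]_n => map_mx intr u *m invmx Aq).
have subM x : @Zn_in_Qn n x -> M x.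
  case=> u _ <-; exists (u *m A) => //.
  by rewrite map_mxM mulmxK.
have eqM x : M x -> @Zn_in_Qn n x.
  move=> Mx; apply: boolp.contrapT => nx; apply: lprim; exists M; split.
  - by exists (invmx Aq); rewrite ?unitmx_inv.
  - move=> _ _ [u _ <-] [v _ <-].
    rewrite bform_mul el !map_mxM /= -[map_mx _ A^T]matrix.map_trmx -/Aq.
    rewrite !mulmxA mulVmx // mul1mx trmx_inv mulmxK ?unitmx_tr //.
    by rewrite -!map_mxM /= /bform matrix.map_trmx -!map_mxM mxE intr_int.
  - by split=> // /(_ x Mx).
(* The rows of [invmx Aq] generate [M], hence are integral vectors. *)
have [B eB] : exists B : 'M[int]_n, map_mx intr B = invmx Aq.
  have rowB i : exists b : 'rV[int]_n, map_mx intr b = row i (invmx Aq).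
    have [|b _ eb] := eqM (row i (invmx Aq)); last by exists b.
    by exists (delta_mx 0 i) => //; rewrite map_delta_mx rowE.
  have [b eb] := fin_all_exists rowB.
  by exists (\matrix_i b i); apply/row_matrixP=> i; rewrite -map_row rowK.
have BA : B *m A = 1%:M.
  by apply: map_intr_inj; rewrite map_mxM map_mx1 eB mulVmx.
exists (T *m B), N, K; rewrite eA; split.
- by rewrite mulmxA -(mulmxA A) S'T mulmx1 (mulmx1C BA).
- by rewrite -mulmxA S'N mulmx0.
- by rewrite -mulmxA (mulmxA B) BA mul1mx.
Qed.

(** * Primitive vectors in rank 2 *)

Lemma det_mx22 (R : comNzRingType) (A : 'M[R]_2) :
  \det A = A 0 0 * A 1 1 - A 0 1 * A 1 0.
Proof.
rewrite (expand_det_row _ 0) !big_ord_recl big_ord0 /cofactor !det_mx11 !mxE.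
have -> : lift 0 0 = 1 :> 'I_2 by exact: val_inj.
have -> : lift 1 0 = 0 :> 'I_2 by exact: val_inj.
by rewrite /= expr0 expr1 mul1r mulN1r mulrN addr0.
Qed.

(** Bezout coefficients [s], [t] of the coprime entries of [u] give the second row [(-t, s)], and
    the determinant is 1. *)
Lemma primitive_vector_completion (u : 'rV[int]_2) :
  primitive_vector u -> exists2 V : 'M[int]_2, V \in unitmx & row 0 V = u.
Proof.
move=> uprim; set p := u 0 0; set q := u 0 1.
have [h eh] : exists h : 'rV[int]_2, u = gcdz p q *: h.
  exists (\row_j (u ord0 j %/ gcdz p q)%Z); apply/rowP=> j; rewrite !mxE mulrC divzK //.
  have : (j == 0) || (j == 1) by case: j => [[|[]]].
  by case/orP=> /eqP->; rewrite ?dvdz_gcdl ?dvdz_gcdr.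
have g1 : gcdz p q = 1 by have := uprim _ _ eh.
have [s [t st]] := Bezoutz p q.
exists (\matrix_(i, j) if i == 0 then u 0 j else if j == 0 then - t else s).
  rewrite unitmxE det_mx22 !mxE /=.
  rewrite [X in X \is a _](_ : _ = 1) ?unitr1 // -g1 -st /p /q; ring.
by apply/rowP=> j; rewrite !mxE.
Qed.

Lemma normz_eq1_of_mul (k m : int) : k * m = 1 -> `|k| = 1.
Proof.
by move/(congr1 absz)/eqP; rewrite abszM muln_eq1 => /andP[/eqP k1 _]; rewrite -abszE k1.
Qed.

Lemma primitive_vector_kernel (c : 'cV[int]_2) :
  c != 0 -> exists2 u : 'rV[int]_2, primitive_vector u & u *m c = 0.
Proof.
move=> c0; set p := c 0 0; set q := c 1 0; set g := gcdz p q.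
have g0 : g != 0.
  apply: contraNneq c0 => /eqP; rewrite gcdz_eq0 => /andP[/eqP p0 /eqP q0].
  apply/eqP/colP=> i; rewrite mxE.
  have : (i == 0) || (i == 1) by case: i => [[|[]]].
  by case/orP=> /eqP->.
have ep : p = (p %/ g)%Z * g by rewrite divzK ?dvdz_gcdl.
have eq : q = (q %/ g)%Z * g by rewrite divzK ?dvdz_gcdr.
pose u : 'rV[int]_2 := \row_j if j == 0 then (q %/ g)%Z else - (p %/ g)%Z.
exists u.
  move=> k y uk.
  have u0 : (q %/ g)%Z = k * y 0 0 by have /rowP/(_ 0) := uk; rewrite !mxE.
  have u1 : - (p %/ g)%Z = k * y 0 1 by have /rowP/(_ 1) := uk; rewrite !mxE.
  have [s [t st]] := Bezoutz p q.
  (* If [u = k *: y], Bezout's identity divided by [g] writes 1 as a multiple of [k]. *)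
  apply: (@normz_eq1_of_mul k (t * y 0 0 - s * y 0 1)); apply: (mulIf g0).
  rewrite mul1r -/g in st *; rewrite -[RHS]st [in RHS]ep [in RHS]eq u0.
  by rewrite -[(p %/ g)%Z]opprK u1; ring.
apply/rowP=> i; rewrite (ord1 i) !mxE !big_ord_recl big_ord0 !mxE /=.
rewrite (_ : lift 0 0 = 1 :> 'I_2); last exact: val_inj.
by rewrite -/p -/q [in LHS]ep [X in _ * X + 0]eq !mulzK //; ring.
Qed.

(** * Binary Gram matrices and invariance under isometry *)

Lemma gram_binary (G : 'M[int]_2) :
  G^T = G -> G = binary_gram (G 0 0) (G 0 1) (G 1 1).
Proof.
move=> Gs; have G10 : G 1 0 = G 0 1 by rewrite -[in LHS]Gs mxE.
have case2 (i : 'I_2) : i = 0 \/ i = 1.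
  by case: i => [[|[|//]] hi]; [left|right]; exact: val_inj.
by apply/matrixP=> i j; rewrite mxE; case: (case2 i) => ->; case: (case2 j) => ->.
Qed.

Lemma det_binary_gram (a b c : int) : \det (binary_gram a b c) = a * c - b ^+ 2.
Proof. by rewrite det_mx22 !mxE. Qed.

Lemma isometric_zlattice (n : nat) (L K : 'M[int]_n) :
  isometric L K -> zlattice L -> zlattice K.
Proof.
move=> /isometricP[V Vu <-] [Ls Lpos]; split.
  by rewrite !trmx_mul trmxK Ls mulmxA.
move=> x x0; rewrite /qform -bform_mul; apply: Lpos.
by apply: contraNneq x0 => /(canRL (mulmxK Vu)) ->; rewrite mul0mx.
Qed.

Lemma isometric_det (n : nat) (L K : 'M[int]_n) : isometric L K -> \det K = \det L.
Proof.
move=> /isometricP[V Vu <-]; rewrite !det_mulmx det_tr mulrAC -expr2.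
by move: Vu; rewrite unitmxE => /orP[] /eqP->; rewrite ?sqrrN expr1n mul1r.
Qed.

Lemma qform_lincomb3 (R : comNzRingType) (n : nat) (G : 'M[R]_n) (Gs : G^T = G)
    (x y z : R) (u v w : 'rV[R]_n) :
  qform G (x *: u + y *: v + z *: w) =
    x ^+ 2 * qform G u + y ^+ 2 * qform G v + z ^+ 2 * qform G w
    + (x * y * bform G u v + x * z * bform G u w + y * z * bform G v w) *+ 2.
Proof.
have dl a b c : bform G (a + b) c = bform G a c + bform G b c.
  by rewrite /bform !mulmxDl mxE.
have dr a b c : bform G c (a + b) = bform G c a + bform G c b.
  by rewrite !(bformC c _ Gs) dl.
have zl k a b : bform G (k *: a) b = k * bform G a b.
  by rewrite /bform -!scalemxAl mxE.
have zr k a b : bform G b (k *: a) = k * bform G b a.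
  by rewrite !(bformC b _ Gs) zl.
rewrite /qform !(dl, dr, zl, zr) (bformC v u Gs) (bformC w u Gs) (bformC w v Gs).
by ring.
Qed.

Lemma zlattice_binary_gram (a b c : int) :
  zlattice (binary_gram a b c) -> 0 < a /\ 0 < a * c - b ^+ 2.
Proof.
case=> Gs Gpos; have e0 : delta_mx 0 0 != 0 :> 'rV[int]_2.
  by apply/eqP=> /rowP/(_ 0); rewrite !mxE.
have coef i j : bform (binary_gram a b c) (delta_mx 0 i) (delta_mx 0 j) = binary_gram a b c i j.
  by rewrite /bform -rowE trmx_delta -colE !mxE.
have a0 : 0 < a by have := Gpos _ e0; rewrite /qform coef mxE.
split=> //.
(* This vector is [a] times the projection of the second basis vector orthogonally to the first; its
   norm is [a * (a * c - b ^+ 2)]. The zero summand only fits the three-term expansion. *)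
have := Gpos ((- b) *: delta_mx 0 0 + a *: delta_mx 0 1 + 0 *: delta_mx 0 0).
rewrite qform_lincomb3 // /qform !coef !mxE /= => Q.
rewrite -(pmulr_rgt0 _ a0).
rewrite [X in 0 < X](_ : _ = (- b) ^+ 2 * a + a ^+ 2 * c + 0 ^+ 2 * a
  + (- b * a * b + - b * 0 * a + a * 0 * b) *+ 2); last by ring.
apply: Q; apply/eqP=> /rowP/(_ 1); rewrite !mxE /= mulr1 mulr0 !(mulr0, addr0, add0r).
by move=> a1; rewrite a1 ltxx in a0.
Qed.

(** * The interval condition and ternary positivity *)

(** Multiplying by [a] and then squaring removes the square root and leaves an inequality between
    integers. *)
Lemma mem_burying_interval (R : realType) (l1 l2 : 'M[int]_2) (a b1 b2 t : int) :
  0 < a -> 0 < \det l1 * \det l2 ->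
  (t%:~R \in burying_interval R l1 l2 a b1 b2) =
  ((a * t - b1 * b2) ^+ 2 < \det l1 * \det l2).
Proof.
move=> a0 d0; rewrite /burying_interval in_itv /=.
have aR : 0 < a%:~R :> R by rewrite ltr0z.
rewrite ltr_pdivrMr // ltr_pdivlMr // -(ltr_int R) rmorphXn /= intrB !intrM.
rewrite -[RHS]ltr_sqrt; last by rewrite -intrM ltr0z.
rewrite sqrtr_sqr ltr_norml.
by rewrite ltrBrDl (ltrBlDl (a%:~R * _)) [t%:~R * _]mulrC.
Qed.

(** Two binary lattices glued along a common first basis vector of norm [a]: indices 0, 1 carry the
    first, indices 0, 2 the second, and [t] is the product of their second basis vectors. *)
Definition ternary_gram (a b1 b2 c1 t c2 : int) : 'M[int]_3 :=
  \matrix_(i, j)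
    nth 0 (nth [::] [:: [:: a; b1; b2]; [:: b1; c1; t]; [:: b2; t; c2]] i) j.

Lemma zlattice_ternary_gram (a b1 b2 c1 t c2 : int) :
  0 < a -> 0 < a * c1 - b1 ^+ 2 ->
  (a * t - b1 * b2) ^+ 2 < (a * c1 - b1 ^+ 2) * (a * c2 - b2 ^+ 2) ->
  zlattice (ternary_gram a b1 b2 c1 t c2).
Proof.
move=> a0 d0 D0; split.
  by apply/matrixP=> [[[|[|[|//]]] ?]] [[|[|[|//]]] ?]; rewrite !mxE.
move=> w w0; set x := w 0 0; set y := w 0 1; set z := w 0 2.
have -> : qform (ternary_gram a b1 b2 c1 t c2) w =
  a * x ^+ 2 + c1 * y ^+ 2 + c2 * z ^+ 2 + (b1 * x * y + b2 * x * z + t * y * z) *+ 2.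
  rewrite /qform /bform !mxE !big_ord_recl big_ord0 !mxE !big_ord_recl !big_ord0 !mxE /=.
  have -> : lift 0 (lift 0 0) = 2 :> 'I_3 by exact: val_inj.
  have -> : lift 0 0 = 1 :> 'I_3 by exact: val_inj.
  by rewrite -/x -/y -/z; ring.
rewrite ltNge; apply/negP=> Q0.
pose d := a * c1 - b1 ^+ 2; pose e := a * t - b1 * b2.
pose D := d * (a * c2 - b2 ^+ 2) - e ^+ 2.
have D1 : 0 < D by rewrite subr_gt0.
(* Completing squares twice diagonalizes [a * d] times the form. *)
have := mulr_ge0_le0 (ltW (mulr_gt0 a0 d0)) Q0.
have -> : a * (a * c1 - b1 ^+ 2) *
  (a * x ^+ 2 + c1 * y ^+ 2 + c2 * z ^+ 2 + (b1 * x * y + b2 * x * z + t * y * z) *+ 2) =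
  d * (a * x + b1 * y + b2 * z) ^+ 2 + (d * y + e * z) ^+ 2 + D * z ^+ 2.
  by rewrite /D /d /e; ring.
have sq1 : 0 <= d * (a * x + b1 * y + b2 * z) ^+ 2 by rewrite mulr_ge0 ?sqr_ge0 ?ltW.
have sq2 := sqr_ge0 (d * y + e * z).
have sq3 : 0 <= D * z ^+ 2 by rewrite mulr_ge0 ?sqr_ge0 ?ltW.
move=> sum0.
have /eqP := le_anti (introT andP (conj sum0 (addr_ge0 (addr_ge0 sq1 sq2) sq3))).
rewrite !paddr_eq0 ?addr_ge0 // => /andP[/andP[s1 s2] s3].
have z0 : z = 0.
  by move: s3; rewrite mulf_eq0 gt_eqF //= sqrf_eq0 => /eqP.
have y0 : y = 0.
  by move: s2; rewrite z0 mulr0 addr0 sqrf_eq0 mulf_eq0 gt_eqF //= => /eqP.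
have x0 : x = 0.
  move: s1; rewrite y0 z0 !mulr0 !addr0 mulf_eq0 gt_eqF //= sqrf_eq0 mulf_eq0.
  by rewrite gt_eqF //= => /eqP.
move/negP: w0; apply; apply/eqP/rowP=> i; rewrite mxE.
have : [|| i == 0, i == 1 | i == 2] by case: i => [[|[|[]]]].
by case/or3P=> /eqP->.
Qed.

(** * Two planes in a ternary lattice and their common line *)

Lemma represented_by_trans (m n p : nat) (K : 'M[int]_m) (L : 'M[int]_n) (M : 'M[int]_p) :
  represented_by K L -> represented_by L M -> represented_by K M.
Proof.
by case=> s es [r er]; exists (r \o s : {linear _ -> _}) => x y; rewrite /= er es.
Qed.

Lemma represented_by_mxsub (m n : nat) (f : 'I_m -> 'I_n) (G : 'M[int]_n) :
  represented_by (mxsub f f G) G.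
Proof.
apply/represented_byP; exists (rowsub f 1%:M); rewrite -rowsubE.
apply: trmx_inj; rewrite trmx_mul trmxK -rowsubE.
by apply/matrixP=> i j; rewrite !mxE.
Qed.

Lemma isometric_represented (n : nat) (L K : 'M[int]_n) :
  isometric L K -> represented_by L K.
Proof. by case=> s _ es; exists s. Qed.

(** The vector [w] completes [u] to a basis; the last clause records this dually, as a functional
    [c] vanishing on both being zero. *)
Lemma primitive_vector_gram (l : 'M[int]_2) (u : 'rV[int]_2) :
  zlattice l -> primitive_vector u ->
  exists2 w : 'rV[int]_2,
    isometric l (binary_gram (qform l u) (bform l u w) (qform l w)) &
    forall c : 'cV[int]_2, u *m c = 0 -> w *m c = 0 -> c = 0.
Proof.
move=> [ls _] /primitive_vector_completion[V Vu Vrow]; exists (row 1 V).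
  apply/isometricP; exists V => //; rewrite [LHS]gram_binary; last first.
    by rewrite !trmx_mul trmxK ls mulmxA.
  have coef i j : (V *m l *m V^T) i j = bform l (row i V) (row j V).
    by rewrite /bform -row_mul tr_row colE mulmxA -row_mul -colE !mxE.
  by rewrite !coef Vrow.
move=> c uc wc; apply: (can_inj (mulKmx Vu)); rewrite mulmx0.
apply/row_matrixP=> i; rewrite row_mul row0.
have : (i == 0) || (i == 1) by case: i => [[|[]]].
by case/orP=> /eqP->; rewrite ?Vrow.
Qed.

(* The vector assumed nonzero is [d1 * p2 - e * p1], where [p1], [p2] are [a] times
   the projections of [y1], [y2] orthogonally to [v]; its norm is
   [a * d1 * (d1 * d2 - e^2)]. *)
Lemma strict_cauchy_schwarz_orthogonal (n : nat) (L : 'M[int]_n) (v y1 y2 : 'rV[int]_n) :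
  let a := qform L v in let b1 := bform L v y1 in let b2 := bform L v y2 in
  let d1 := a * qform L y1 - b1 ^+ 2 in
  let d2 := a * qform L y2 - b2 ^+ 2 in
  let e := a * bform L y1 y2 - b1 * b2 in
  zlattice L -> 0 < a -> 0 < d1 ->
  (e * b1 - d1 * b2) *: v + (- (e * a)) *: y1 + (d1 * a) *: y2 != 0 ->
  e ^+ 2 < d1 * d2.
Proof.
move=> a b1 b2 d1 d2 e [Ls Lpos] a0 d0 z0.
have := Lpos _ z0; rewrite qform_lincomb3 // -/a -/b1 -/b2.
rewrite [X in 0 < X](_ : _ = a * d1 * (d1 * d2 - e ^+ 2)); last first.
  by rewrite /d2 /e /d1; ring.
by rewrite pmulr_rgt0 ?mulr_gt0 // subr_gt0.
Qed.

(** The functional [N] has the image of [l1] as its kernel. Restricted to [l2] it is nonzero, so its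
    kernel there contains a primitive [u2], whose image lies in both planes. *)
Lemma common_primitive_vector (L : 'M[int]_3) (l1 l2 : 'M[int]_2) :
  zlattice L -> zlattice l1 -> zlattice l2 ->
  primitive_lattice l1 -> primitive_lattice l2 -> ~ buried 2 l1 l2 ->
  represented_by l1 L -> represented_by l2 L ->
  exists S1 S2 (N : 'cV[int]_3) u1 u2,
    [/\ S1 *m L *m S1^T = l1, S2 *m L *m S2^T = l2,
        primitive_vector u1 & primitive_vector u2] /\
    [/\ u1 *m S1 = u2 *m S2, S1 *m N = 0 & S2 *m N != 0].
Proof.
move=> zL z1 z2 p1 p2 nb /represented_byP[S1 e1] /represented_byP[S2 e2].
have [T1 [N [K [S1T S1N TN]]]] :=
  @primitive_saturated 2 1 _ _ _ (zlattice_det_neq0 z1) p1 e1.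
have [T2 [_ [_ [S2T _ _]]]] :=
  @primitive_saturated 2 1 _ _ _ (zlattice_det_neq0 z2) p2 e2.
have split1 (m : nat) (A : 'M_(m, 3)) : A *m N = 0 -> A = A *m T1 *m S1.
  by move=> AN; rewrite -{1}(mulmx1 A) -TN mulmxDr !mulmxA AN mul0mx addr0.
have S2N : S2 *m N != 0.
  (* Otherwise [S2] factors through [S1], and [l1] itself represents both lattices in rank 2. *)
  apply/eqP=> /split1 eS2; apply: nb; exists l1; split=> //.
    by exists idfun.
  by apply/represented_byP; exists (S2 *m T1); rewrite -[RHS]e2 [in RHS]eS2 -e1 !trmx_mul !mulmxA.
have [u2 u2p u2N] := primitive_vector_kernel S2N.
have eu : u2 *m S2 = u2 *m S2 *m T1 *m S1 by apply: split1; rewrite -mulmxA.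
exists S1, S2, N, (u2 *m S2 *m T1), u2; split; split=> // k y uk.
(* A factor [k] of [u1] is carried by [S1] and then [T2], a right inverse of [S2], to a factor of
   [u2]. *)
apply: (u2p k (y *m S1 *m T2)); rewrite -[LHS]mulmx1 -S2T mulmxA eu uk.
by rewrite -!scalemxAl.
Qed.

Theorem theorem3p10 (R : realType) (l1 l2 : 'M[int]_2)
    (hl1 : zlattice l1) (hl2 : zlattice l2)
    (hp1 : primitive_lattice l1) (hp2 : primitive_lattice l2)
    (hnb : ~ buried 2 l1 l2) :
  buried 3 l1 l2 <->
  exists a : int,
    [/\ 0 < a, primitively_represents l1 a, primitively_represents l2 a &
      exists b1 c1 b2 c2 : int,
        [/\ isometric l1 (binary_gram a b1 c1),
            isometric l2 (binary_gram a b2 c2) &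
            exists t : int, t%:~R \in burying_interval R l1 l2 a b1 b2]].
Proof.
split=> [[L [zL r1 r2]] | [a [a0 _ _ [b1 [c1 [b2 [c2 [i1 i2 [t tI]]]]]]]]].
  have [S1 [S2 [N [u1 [u2 [[e1 e2 u1p u2p] [eu S1N S2N]]]]]]] :=
    common_primitive_vector zL hl1 hl2 hp1 hp2 hnb r1 r2.
  have [w1 i1 _] := primitive_vector_gram hl1 u1p.
  have [w2 i2 w2N] := primitive_vector_gram hl2 u2p.
  have bf1 x y : bform l1 x y = bform L (x *m S1) (y *m S1) by rewrite -e1 bform_mul.
  have bf2 x y : bform l2 x y = bform L (x *m S2) (y *m S2) by rewrite -e2 bform_mul.
  have a12 : qform l2 u2 = qform l1 u1 by rewrite /qform bf1 bf2 eu.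
  rewrite a12 in i2.
  have [a0 d1] := zlattice_binary_gram (isometric_zlattice i1 hl1).
  have [_ d2] := zlattice_binary_gram (isometric_zlattice i2 hl2).
  exists (qform l1 u1); split=> //; first by exists u1.
    by exists u2.
  exists (bform l1 u1 w1), (qform l1 w1), (bform l2 u2 w2), (qform l2 w2); split=> //.
  exists (bform L (w1 *m S1) (w2 *m S2)).
  rewrite mem_burying_interval // -(isometric_det i1) -(isometric_det i2) !det_binary_gram;
    last exact: mulr_gt0.
  move: a0 d1 d2; rewrite /qform !bf1 !bf2 -eu => a0 d1 d2.
  apply: strict_cauchy_schwarz_orthogonal => //.
  (* [N] kills the common vector and [w1 *m S1], so a vanishing combination would make [N] vanish on
     [w2 *m S2]. It would then vanish on a basis of the second plane, against [S2 *m N != 0]. *)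
  apply: contraNneq S2N => /(congr1 (mulmx^~ N)).
  rewrite !mulmxDl mul0mx -!scalemxAl -!mulmxA S1N !mulmx0 !scaler0 !add0r.
  move/eqP; rewrite scalemx_eq0 mulf_eq0 !gt_eqF //= => /eqP w2S2N.
  by apply/eqP/w2N; rewrite // mulmxA -eu -mulmxA S1N mulmx0.
have [_ d1] := zlattice_binary_gram (isometric_zlattice i1 hl1).
have [_ d2] := zlattice_binary_gram (isometric_zlattice i2 hl2).
move: tI; rewrite mem_burying_interval // -(isometric_det i1) -(isometric_det i2)
  !det_binary_gram; last exact: mulr_gt0.
move=> tI; exists (ternary_gram a b1 b2 c1 t c2); split.
- exact: zlattice_ternary_gram.
- apply: represented_by_trans (isometric_represented i1) _.
  have -> : binary_gram a b1 c1 =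
    let f (i : 'I_2) := if i == 0 then 0 else 1 in mxsub f f (ternary_gram a b1 b2 c1 t c2).
    by apply/matrixP=> [[[|[|//]] ?]] [[|[|//]] ?]; rewrite !mxE.
  exact: represented_by_mxsub.
- apply: represented_by_trans (isometric_represented i2) _.
  have -> : binary_gram a b2 c2 =
    let f (i : 'I_2) := if i == 0 then 0 else 2 in mxsub f f (ternary_gram a b1 b2 c1 t c2).
    by apply/matrixP=> [[[|[|//]] ?]] [[|[|//]] ?]; rewrite !mxE.
  exact: represented_by_mxsub.
Qed.
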